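(* Let $d$ be a positive integer and $0\le k\le n$ integers. Then $$\left\langle \begin{matrix} n\\ k\end{matrix}\right\rangle_d=\det\left(\binom{n+i+j}{k+j}\right)_{i,j=0}^{d-1}=\det\left(\binom{n}{k+i-j}\right)_{i,j=0}^{d-1}.$$
   Context: For a positive integer $d$ and integer $m\ge0$, $\langle m\rangle_d=\binom{m+d-1}{d}$. For $0\le k\le n$, $\left\langle \begin{matrix} n\\ k\end{matrix}\right\rangle_d=\prod_{j=0}^{k-1}\frac{\langle n-j\rangle_d}{\langle k-j\rangle_d}$. Binomial coefficients $\binom{n}{m}$ with $m<0$ or $m>n$ are $0$. *)

(* Defs.v *)
From mathcomp Require Import all_boot all_order all_algebra.

Set Implicit Arguments.
Unset Strict Implicit.
Unset Printing Implicit Defensive.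

Import GRing.Theory.
Local Open Scope ring_scope.

(* Used for d > 0, where the truncated m + d - 1 is the true difference. *)
Definition hoggatt_nat (d m : nat) : nat := 'C(m + d - 1, d).

(* Used for d > 0 and k <= n: for j < k the subtractions n - j and k - j are
   not truncated, and since k - j > 0 no denominator vanishes.  It is valued in
   rat because its integrality is not evident from the defining product. *)
Definition hoggatt_binomial (d n k : nat) : rat :=
  \prod_(0 <= j < k) ((hoggatt_nat d (n - j))%:R / (hoggatt_nat d (k - j))%:R).

(* Binomial coefficient with an integer lower index, zero for negative m;
   the case m > n is already zero for 'C(n, m). *)
Definition binz (n : nat) (m : int) : nat :=
  match m with
  | Posz m' => 'C(n, m')
  | Negz _ => 0%N
  end.

(* Main.v *)
Require Import Defs.
From mathcomp Require Import all_boot all_order all_algebra.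
From mathcomp Require Import zify ring.

Import GRing.Theory.
Local Open Scope ring_scope.

(* Iterating Pascal's rule (Vandermonde's identity) in the row index factors
    [('C(n + i + j, k + j))] as [L *m N *m U] with [L], [U] unitriangular and [N]
    the transpose of the second matrix, and factors [('C(n + i + j, i))] as a
    product of two unitriangular matrices. The first matrix is the latter one with
    rows scaled by [i! / (n - k + i)!] and columns by [(n + j)! / (k + j)!], so its
    determinant is [\prod_i (n + i)^_k / (k + i)^_k]. Since
    [d! <m>_d = m (m + 1) ... (m + d - 1)], exchanging the two products turns
    this into the Hoggatt binomial. *)

(** The step [e] is left free so that one induction serves both the falling and the rising lower
    index. Any [d] above [m] is allowed, since the extra coefficients ['C(m, a)] vanish; sums can
    thus run over matrix indices. *)
Lemma pascal_iter (R : pzRingType) (f : nat -> int -> R) (e : int) :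
  (forall n z, f n.+1 z = f n z + f n (z + e)) ->
  forall (d m n : nat) (z : int), (m < d)%N ->
  f (m + n)%N z = \sum_(a < d) 'C(m, a)%:R * f n (z + e * (a : nat)%:Z).
Proof.
move=> fS d m n z; elim: m d z => [|m IHm] [|d] z //.
  move=> _; rewrite big_ord_recl big1 ?addr0 => [|i _].
    by rewrite mulr0 addr0 bin0 mul1r.
  by rewrite bin0n mul0r.
(* With bounds [d.+1] and [d], the first sum without its term at 0 aligns with the second, and
   Pascal's rule merges coefficients. *)
rewrite ltnS => lt_md; rewrite addSn fS (IHm d.+1) 1?ltnW // (IHm d) //.
rewrite !big_ord_recl !bin0 -addrA -big_split /=; congr (_ + _).
apply: eq_bigr => i _; rewrite /bump /= binS natrD mulrDl; congr (_ + _ * f _ _).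
lia.
Qed.

Lemma binzS (n : nat) (z : int) : binz n.+1 z = (binz n z + binz n (z - 1))%N.
Proof.
case: z => [[|m]|m]; first by rewrite /= !bin0.
  have -> : m.+1%:Z - 1 = m%:Z by lia.
  by rewrite /= binS.
by have -> : Negz m - 1 = Negz m.+1 by lia.
Qed.

Lemma binz_Vandermonde (d m n : nat) (z : int) : (m < d)%N ->
  (binz (m + n) z)%:R =
  \sum_(a < d) 'C(m, a)%:R * (binz n (z - (a : nat)%:Z))%:R :> rat.
Proof.
move=> lt_md; rewrite (@pascal_iter _ (fun n z => (binz n z)%:R) (-1) _ d) //.
  by apply: eq_bigr => a _; rewrite mulN1r.
by move=> p y; rewrite binzS natrD.
Qed.

Lemma binz_Vandermonde_rev (d m n : nat) (z : int) : (m < d)%N ->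
  (binz (m + n) (z + m%:Z))%:R =
  \sum_(a < d) 'C(m, a)%:R * (binz n (z + (a : nat)%:Z))%:R :> rat.
Proof.
move=> lt_md.
(* Along the diagonals [y + p], Pascal's rule has step 1. *)
have := @pascal_iter rat (fun p y => (binz p (y + p%:Z))%:R) 1 _ d m n (z - n%:Z).
rewrite (_ : z - n%:Z + (m + n)%N%:Z = z + m%:Z); last by lia.
move=> -> //.
  apply: eq_bigr => a _; congr (_ * (binz _ _)%:R); lia.
move=> p y; rewrite binzS natrD addrC.
by congr ((binz _ _)%:R + (binz _ _)%:R); lia.
Qed.

Lemma det_unitrig (R : comPzRingType) (d : nat) (A : 'M[R]_d) :
  (forall i j : 'I_d, (i < j)%N -> A i j = 0) -> (forall i, A i i = 1) ->
  \det A = 1.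
Proof.
move=> A0 A1; rewrite det_trig; first by apply: big1 => i _.
by apply/is_trig_mxP.
Qed.

Lemma det_pascal (d : nat) :
  \det (\matrix_(i < d, j < d) 'C(i, j)%:R : 'M[rat]_d) = 1.
Proof.
by apply: det_unitrig => [i j lt_ij | i]; rewrite mxE ?binn // bin_small.
Qed.

Lemma det_bin_binz (d n k : nat) :
  \det (\matrix_(i < d, j < d) ('C(n + i + j, k + j))%:R : 'M[rat]_d)
    = \det (\matrix_(i < d, j < d)
              (binz n (k%:Z + (i : nat)%:Z - (j : nat)%:Z))%:R : 'M[rat]_d).
Proof.
set N := (X in _ = \det X).
pose P : 'M[rat]_d := \matrix_(i < d, j < d) 'C(i, j)%:R.
suff -> : (\matrix_(i < d, j < d) ('C(n + i + j, k + j))%:R : 'M[rat]_d)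
          = P *m (N^T *m P^T).
  by rewrite !det_mulmx !det_tr det_pascal mul1r mulr1.
apply/matrixP => i j; rewrite !mxE.
(* Expanding in [i] lowers the lower index by [a]; expanding in [j] then replaces its summand [j] by
   [b], leaving [binz n (k - a + b)]. *)
have -> : 'C(n + i + j, k + j) = binz (i + (j + n)) (k%:Z + (j : nat)%:Z).
  by rewrite -PoszD /=; congr 'C(_, _); lia.
rewrite (@binz_Vandermonde d) //; apply: eq_bigr => a _; rewrite !mxE.
congr (_ * _); rewrite addrAC (@binz_Vandermonde_rev d) //.
by apply: eq_bigr => b _; rewrite !mxE mulrC addrAC.
Qed.

Lemma det_bin_diag (d n : nat) :
  \det (\matrix_(i < d, j < d) ('C(n + i + j, i))%:R : 'M[rat]_d) = 1.
Proof.
pose P : 'M[rat]_d := \matrix_(i < d, j < d) 'C(i, j)%:R.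
pose L : 'M[rat]_d :=
  \matrix_(i < d, j < d) (binz (n + i) ((i : nat)%:Z - (j : nat)%:Z))%:R.
rewrite (_ : \matrix_(i, j) _ = L *m P^T).
  rewrite det_mulmx det_tr det_pascal mulr1.
  apply: det_unitrig => [i j lt_ij | i]; rewrite mxE; last by rewrite subrr /= bin0.
  (* Above the diagonal [binz] has a negative lower index. *)
  have : (i : nat)%:Z - (j : nat)%:Z < 0 by lia.
  by case: (_ - _).
apply/matrixP => i j; rewrite !mxE.
rewrite -[X in X%:R]/(binz (n + i + j) (i : nat)%:Z) addnC (@binz_Vandermonde d) //.
by apply: eq_bigr => a _; rewrite !mxE mulrC.
Qed.

Lemma fact_neq0 (n : nat) : n`!%:R != 0 :> rat.
Proof. by rewrite Num.Theory.pnatr_eq0 -lt0n fact_gt0. Qed.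

Lemma det_bin_prod (d n k : nat) : (k <= n)%N ->
  \det (\matrix_(i < d, j < d) ('C(n + i + j, k + j))%:R : 'M[rat]_d)
    = \prod_(i < d) (((n + i) ^_ k)%:R / ((k + i) ^_ k)%:R).
Proof.
move=> le_kn.
pose D : 'rV[rat]_d := \row_(i < d) (i`!%:R / (n - k + i)`!%:R).
pose E : 'rV[rat]_d := \row_(i < d) ((n + i)`!%:R / (k + i)`!%:R).
rewrite (_ : \matrix_(i, j) _ =
  diag_mx D *m (\matrix_(i < d, j < d) ('C(n + i + j, i))%:R *m diag_mx E)).
  rewrite !det_mulmx !det_diag det_bin_diag mul1r -big_split /=.
  apply: eq_bigr => i _; rewrite !mxE.
  (* Regrouping the [i]-th entries of [D] and [E] pairs [(n + i)!] with [(n - k + i)!] and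
     [(k + i)!] with [i!]; each quotient is a falling factorial. *)
  have := @ffact_fact (n + i) k; have := @ffact_fact (k + i) k.
  rewrite leq_addr => /(_ isT) <-; rewrite addKn.
  rewrite (leq_trans le_kn) ?leq_addr // => /(_ isT) <-; rewrite addnBAC //.
  rewrite !natrM; field; rewrite !fact_neq0 Num.Theory.pnatr_eq0 -lt0n ffact_gt0.
  by rewrite leq_addr.
apply/matrixP => i j; rewrite mul_diag_mx mul_mx_diag !mxE.
have lekj : (k + j <= n + i + j)%N by lia.
have lei : (i <= n + i + j)%N by lia.
(* Both binomials have the numerator [(n + i + j)!], which is eliminated. *)
have := bin_fact lekj; have := bin_fact lei.
rewrite (_ : n + i + j - i = n + j)%N; last by lia.
rewrite (_ : n + i + j - (k + j) = n - k + i)%N; last by lia.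
move=> <- /(congr1 (fun m : nat => m%:R : rat)); rewrite !natrM => eqf.
have nz := fact_neq0; have a0 := mulf_neq0 (nz (k + j)%N) (nz (n - k + i)%N).
apply: (mulIf a0); rewrite eqf; field.
by rewrite !nz.
Qed.

Lemma hoggatt_nat_prod (d m : nat) :
  (hoggatt_nat d m * d`! = \prod_(i < d) (m + i))%N.
Proof.
rewrite bin_ffact ffact_prod (reindex_inj rev_ord_inj) /=.
by apply: eq_bigr => i _ /=; have := ltn_ord i; lia.
Qed.

Lemma hoggatt_binomial_prod (d n k : nat) : (k <= n)%N ->
  hoggatt_binomial d n k
    = \prod_(i < d) (((n + i) ^_ k)%:R / ((k + i) ^_ k)%:R).
Proof.
move=> le_kn; rewrite /hoggatt_binomial big_mkord.
transitivity (\prod_(j < k) \prod_(i < d)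
  ((n - j + i)%N%:R / (k - j + i)%N%:R : rat)).
  apply: eq_bigr => j _; rewrite big_split /= prodfV -!natr_prod.
  (* The factors [d!] above and below the fraction bar cancel. *)
  rewrite -!hoggatt_nat_prod.
  by rewrite !natrM -mulf_div divff ?mulr1 ?fact_neq0.
rewrite exchange_big /=; apply: eq_bigr => i _.
rewrite !ffact_prod big_split /= prodfV -!natr_prod.
(* As [j < k <= n], no subtraction is truncated, so [n - j + i] equals [n + i - j], a factor of
   [(n + i) ^_ k]. *)
by congr (_%:R / _%:R); apply: eq_bigr => j _; have := ltn_ord j; lia.
Qed.

Theorem theorem2 (d n k : nat) (hd : (0 < d)%N) (hkn : (k <= n)%N) :
  hoggatt_binomial d n k
    = \det (\matrix_(i < d, j < d) ('C(n + i + j, k + j))%:R : 'M[rat]_d)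
  /\
  \det (\matrix_(i < d, j < d) ('C(n + i + j, k + j))%:R : 'M[rat]_d)
    = \det (\matrix_(i < d, j < d)
              (binz n (k%:Z + (i : nat)%:Z - (j : nat)%:Z))%:R : 'M[rat]_d).
Proof.
split; last exact: det_bin_binz.
by rewrite hoggatt_binomial_prod // det_bin_prod.
Qed.
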